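(* Fix a time index $n\ge1$ and $(\mathbf u_h^{n-1},\xi_h^{n-1},p_h^{n-1})\in \mathbf V_h\times W_h\times M_h$. Let $(\mathbf u_h^n,\xi_h^n,p_h^n)$ be the solution of the $n$-th step of the coupled algorithm, and let $(\mathbf u_h^{n,i},\xi_h^{n,i},p_h^{n,i})_{i\ge 0}$ be the iterates of the iterative decoupled algorithm in the same time step (both defined in the context, with the same previous-step values). Set $e_{\mathbf u}^i=\mathbf u_h^{n,i}-\mathbf u_h^n$, $e_\xi^i=\xi_h^{n,i}-\xi_h^n$, $e_p^i=p_h^{n,i}-p_h^n$. If $c_0=0$, then the iterative decoupled algorithm is also convergent: $$\lim_{i\to\infty}\|e_\xi^i\|_{L^2(\Omega)}=0,\qquad \lim_{i\to\infty}\|\varepsilon(e_{\mathbf u}^i)\|_{L^2(\Omega)}=0,\qquad \lim_{i\to\infty}\|e_p^i\|_{L^2(\Omega)}=0.$$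
   Context: Setting. $\Omega\subset\mathbb R^d$ ($d=2$ or $3$) is a bounded polygonal (polyhedral) domain, with $\partial\Omega=\Gamma_d\cup\Gamma_t=\Gamma_p\cup\Gamma_f$, $|\Gamma_d|>0$, $|\Gamma_p|>0$ ($\Gamma_d,\Gamma_p$ are the Dirichlet parts for displacement and pressure, $\Gamma_t,\Gamma_f$ the Neumann parts). $(\cdot,\cdot)$ is the $L^2(\Omega)$ inner product and $\langle\cdot,\cdot\rangle_\Gamma$ the $L^2(\Gamma)$ inner product; $\varepsilon(\mathbf u)=\frac12(\nabla\mathbf u+(\nabla\mathbf u)^T)$. Parameters: $\mu>0$, $\lambda>0$, $c_0\ge 0$, $\alpha>0$ (Biot–Willis constant), $K>0$ (hydraulic conductivity), time step $\Delta t>0$. Time-independent data: $\mathbf f\in \mathbf L^2(\Omega)$, $\mathbf h\in\mathbf L^2(\Gamma_t)$, $Q_s\in L^2(\Omega)$, $g_2\in L^2(\Gamma_f)$. Finite element spaces on a triangulation $T_h$ of $\Omega$ (Taylor–Hood for $(\mathbf u,\xi)$, $P_1$ for $p$): $\mathbf V_h=\{\mathbf v_h\in \mathbf C^0(\bar\Omega): \mathbf v_h|_{\Gamma_d}=0,\ \mathbf v_h|_\tau\in \mathbf P_2(\tau)\ \forall\tau\in T_h\}$, $W_h=\{\phi_h\in C^0(\bar\Omega):\phi_h|_\tau\in P_1(\tau)\ \forall \tau\in T_h\}$, $M_h=\{\psi_h\in C^0(\bar\Omega):\psi_h|_{\Gamma_p}=0,\ \psi_h|_\tau\in P_1(\tau)\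 \forall\tau\in T_h\}$. Standing property: $\mathbf V_h\times W_h$ is a stable Stokes pair, i.e. there is $\beta_0^*>0$ independent of $h$ with $\sup_{\mathbf u_h\in\mathbf V_h}\frac{(\operatorname{div}\mathbf u_h,q)}{\|\mathbf u_h\|_{H^1(\Omega)}}\ge\beta_0^*\|q\|_{L^2(\Omega)}$ for all $q\in W_h$. Coupled algorithm, $n$-th step: given $(\mathbf u_h^{n-1},\xi_h^{n-1},p_h^{n-1})$, find $(\mathbf u_h^n,\xi_h^n,p_h^n)\in\mathbf V_h\times W_h\times M_h$ such that for all $(\mathbf v_h,\phi_h,\psi_h)\in \mathbf V_h\times W_h\times M_h$: $$2\mu(\varepsilon(\mathbf u_h^n),\varepsilon(\mathbf v_h))-(\xi_h^n,\operatorname{div}\mathbf v_h)=(\mathbf f,\mathbf v_h)+\langle\mathbf h,\mathbf v_h\rangle_{\Gamma_t},$$ $$(\operatorname{div}\mathbf u_h^n,\phi_h)+\tfrac1\lambda(\xi_h^n,\phi_h)-\tfrac\alpha\lambda(p_h^n,\phi_h)=0,$$ $$(c_0+\tfrac{\alpha^2}\lambda)(p_h^n,\psi_h)-\tfrac\alpha\lambda(\xi_h^n,\psi_h)+K\Delta t(\nabla p_h^n,\nabla\psi_h)=\Delta t(Q_s,\psi_h)+\Delta t\langle g_2,\psi_h\rangle_{\Gamma_f}+(c_0+\tfrac{\alpha^2}\lambda)(p_h^{n-1},\psi_h)-\tfrac\alpha\lambda(\xi_h^{n-1},\psi_h).$$ Iterative decoupled algorithm in time step $n$: initialize $\mathbf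 u_h^{n,0}=\mathbf u_h^{n-1}$, $\xi_h^{n,0}=\xi_h^{n-1}$, $p_h^{n,0}=p_h^{n-1}$. For $i\ge 1$: Step 1: given $\xi_h^{n,i-1}\in W_h$, find $p_h^{n,i}\in M_h$ such that for all $\psi_h\in M_h$ $$(c_0+\tfrac{\alpha^2}\lambda)(p_h^{n,i},\psi_h)+K\Delta t(\nabla p_h^{n,i},\nabla\psi_h)=(c_0+\tfrac{\alpha^2}\lambda)(p_h^{n-1},\psi_h)+\tfrac\alpha\lambda(\xi_h^{n,i-1}-\xi_h^{n-1},\psi_h)+\Delta t(Q_s,\psi_h)+\Delta t\langle g_2,\psi_h\rangle_{\Gamma_f}.$$ Step 2: given $p_h^{n,i}$, find $(\mathbf u_h^{n,i},\xi_h^{n,i})\in\mathbf V_h\times W_h$ such that for all $(\mathbf v_h,\phi_h)\in\mathbf V_h\times W_h$ $$2\mu(\varepsilon(\mathbf u_h^{n,i}),\varepsilon(\mathbf v_h))-(\xi_h^{n,i},\operatorname{div}\mathbf v_h)=(\mathbf f,\mathbf v_h)+\langle\mathbf h,\mathbf v_h\rangle_{\Gamma_t},\qquad (\operatorname{div}\mathbf u_h^{n,i},\phi_h)+\tfrac1\lambda(\xi_h^{n,i},\phi_h)=\tfrac\alpha\lambda(p_h^{n,i},\phi_h).$$ *)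

(* Defs.v *)
(* Points of R^d are row vectors over an arbitrary [R : realType] of
   MathComp-Analysis. *)
From HB Require Import structures.
From mathcomp Require Import all_boot all_order all_algebra.
From mathcomp Require Import all_classical all_reals all_analysis.
From mathcomp Require mpoly.
(* the notations of mpoly clash with those of MathComp-Analysis *)
Import (canonicals, coercions) mpoly.

Set Implicit Arguments.
Unset Strict Implicit.
Unset Printing Implicit Defensive.
Import Order.TTheory GRing.Theory Num.Theory.
Import numFieldNormedType.Exports.
Local Open Scope classical_set_scope.
Local Open Scope ring_scope.

Section cover_outer.
Context {R : realType} {T : pointedType}.
Local Open Scope ereal_scope.

Definition cover_outer (zeta : set T -> \bar R) (X : set T) : \bar R :=
  ereal_inf [set \sum_(k <oo) zeta (A k) |
             A in [set A : (set T)^nat | X `<=` \bigcup_k A k]].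

Variable zeta : set T -> \bar R.
Hypotheses (zeta0 : zeta set0 = 0) (zeta_ge0 : forall A, 0 <= zeta A).

(* [mu_ext] over the sigma-algebra of all subsets of [T] *)
Let cover_outerE :
  cover_outer zeta = @mu_ext _ (g_sigma_algebraType [set: set T]) R zeta.
Proof.
apply/funext => X; rewrite /cover_outer /mu_ext; congr (ereal_inf (image _ _)).
apply/seteqP; split => A /=; last by case.
by move=> XA; split => // i; exact: sub_sigma_algebra.
Qed.

Lemma cover_outer0 : cover_outer zeta set0 = 0.
Proof. by rewrite cover_outerE; exact: mu_ext0. Qed.

Lemma cover_outer_ge0 A : 0 <= cover_outer zeta A.
Proof. by rewrite cover_outerE; exact: mu_ext_ge0. Qed.

Lemma le_cover_outer : {homo cover_outer zeta : A B / A `<=` B >-> A <= B}.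
Proof.
move=> A B; rewrite cover_outerE.
exact: (@le_mu_ext _ (g_sigma_algebraType [set: set T])).
Qed.

Lemma cover_outer_sigma_subadditive : sigma_subadditive (cover_outer zeta).
Proof.
by move=> F; rewrite cover_outerE; exact: mu_ext_sigma_subadditive.
Qed.

End cover_outer.

Section lebesgue.
Context {R : realType} {d : nat}.
Local Open Scope ereal_scope.

Definition box (a b : 'rV[R]_d) : set 'rV[R]_d :=
  [set x | forall j, (a 0%R j < x 0%R j <= b 0%R j)%R].

(* Smallest volume of a box containing [A].  The clause for the empty set is
   only needed when [d = 0], where every box has volume 1. *)
Definition box_gauge (A : set 'rV[R]_d) : \bar R :=
  ereal_inf [set v | (A = set0 /\ v = 0) \/
    exists a b : 'rV[R]_d, [/\ forall j, (a 0%R j <= b 0%R j)%R,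
      A `<=` box a b & v = (\prod_j (b 0%R j - a 0%R j)%R)%:E]].

Definition lebesgue_outer (A : set 'rV[R]_d) : \bar R :=
  cover_outer box_gauge A.

Lemma box_gauge_ge0 A : 0 <= box_gauge A.
Proof.
apply: le_ereal_inf_tmp => v [[_ ->//]|[a [b [ab _ ->]]]].
by rewrite lee_fin prodr_ge0// => j _; rewrite subr_ge0.
Qed.

Lemma box_gauge0 : box_gauge set0 = 0.
Proof.
apply/eqP; rewrite eq_le box_gauge_ge0 andbT.
by apply: ereal_inf_lbound; left.
Qed.

HB.instance Definition _ := isOuterMeasure.Build R 'rV[R]_d lebesgue_outer
  (cover_outer0 box_gauge0 box_gauge_ge0)
  (cover_outer_ge0 box_gauge_ge0)
  (le_cover_outer box_gauge)
  (cover_outer_sigma_subadditive box_gauge_ge0).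

End lebesgue.

Definition leb_outer (R : realType) (d : nat)
    : {outer_measure set 'rV[R]_d -> \bar R} := @lebesgue_outer R d.

(* R^d with the Lebesgue sigma-algebra, and the Lebesgue measure on it *)
Notation lebType R d := (caratheodory_type (leb_outer R d)).
Definition leb (R : realType) (d : nat)
    : {measure set (lebType R d) -> \bar R} :=
  leb_outer R d : set (lebType R d) -> \bar R.

Section hausdorff.
Context {R : realType} {d : nat}.

(* The library norm on ['rV_d] is the maximum norm. *)
Definition enorm (x : 'rV[R]_d) : R := Num.sqrt (\sum_j x 0 j ^+ 2).

Definition ediam (A : set 'rV[R]_d) : \bar R :=
  ereal_sup [set z | exists x y, [/\ A x, A y & z = (enorm (x - y))%:E]].

(* volume of the unit ball of R^s *)
Fixpoint ball_volume (s : nat) : R :=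
  match s with
  | 0 => 1
  | 1 => 2
  | (s'.+2) as s => 2 * pi / s%:R * ball_volume s'
  end.

Definition hausdorff_gauge (s : nat) (delta : R) (A : set 'rV[R]_d)
    : \bar R :=
  if `[< A = set0 >] then 0%E
  else if (ediam A <= delta%:E)%E
  then (ball_volume s * (fine (ediam A) / 2) ^+ s)%:E
  else +oo%E.

Definition hausdorff_outer (s : nat) (A : set 'rV[R]_d) : \bar R :=
  ereal_sup [set cover_outer (hausdorff_gauge s delta) A |
             delta in [set delta : R | 0 < delta]].

Lemma ball_volume_ge0 s : 0 <= ball_volume s.
Proof.
have [m le_sm] := ubnP s; elim: m s le_sm => // m IH [|[|s]] //= sm.
rewrite mulr_ge0 ?IH//; last by rewrite -ltnS (leq_trans _ sm)// ltnW.
by rewrite divr_ge0// mulr_ge0// pi_ge0.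
Qed.

Lemma hausdorff_gauge0 s delta : hausdorff_gauge s delta set0 = 0%E.
Proof. by rewrite /hausdorff_gauge asboolT. Qed.

Lemma hausdorff_gauge_ge0 s delta A : (0 <= hausdorff_gauge s delta A)%E.
Proof.
rewrite /hausdorff_gauge; case: asboolP => // /eqP/set0P[x Ax].
case: ifP => // _; rewrite lee_fin mulr_ge0 ?ball_volume_ge0//.
rewrite exprn_ge0// divr_ge0// fine_ge0//.
apply: (@le_trans _ _ (enorm (x - x))%:E); first by rewrite lee_fin sqrtr_ge0.
by apply: ereal_sup_ubound; exists x, x.
Qed.

Let H0 s delta := hausdorff_gauge0 s delta.
Let Hge0 s delta := hausdorff_gauge_ge0 s delta.

Lemma hausdorff_outer0 s : hausdorff_outer s set0 = 0%E.
Proof.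
apply/eqP; rewrite eq_le; apply/andP; split.
  by apply: ge_ereal_sup => _ [delta _ <-]; rewrite (cover_outer0 (H0 _ _)).
apply: ereal_sup_ubound; exists 1 => /=; first exact: ltr01.
exact: (cover_outer0 (H0 _ _) (Hge0 _ _)).
Qed.

Lemma hausdorff_outer_ge0 s A : (0 <= hausdorff_outer s A)%E.
Proof.
apply: (le_trans (cover_outer_ge0 (Hge0 s 1) A)).
by apply: ereal_sup_ubound; exists 1 => //=; exact: ltr01.
Qed.

Lemma le_hausdorff_outer s :
  {homo hausdorff_outer s : A B / A `<=` B >-> (A <= B)%E}.
Proof.
move=> A B AB; apply: ge_ereal_sup => _ [delta delta0 <-].
apply: (le_trans (le_cover_outer _ AB)).
by apply: ereal_sup_ubound; exists delta.
Qed.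

Lemma hausdorff_outer_sigma_subadditive s :
  sigma_subadditive (hausdorff_outer s).
Proof.
move=> F; apply: ge_ereal_sup => _ [delta delta0 <-].
apply: (le_trans (cover_outer_sigma_subadditive (Hge0 s delta) F)).
apply: lee_nneseries => [n _ _|n _]; first exact: cover_outer_ge0.
by apply: ereal_sup_ubound; exists delta.
Qed.

HB.instance Definition _ s := isOuterMeasure.Build R 'rV[R]_d
  (hausdorff_outer s) (hausdorff_outer0 s) (hausdorff_outer_ge0 s)
  (@le_hausdorff_outer s) (@hausdorff_outer_sigma_subadditive s).

End hausdorff.

Definition surf_outer (R : realType) (d : nat)
    : {outer_measure set 'rV[R]_d -> \bar R} := @hausdorff_outer R d d.-1.

(* Surface measure: the (d-1)-dimensional Hausdorff measure on R^d *)
Notation surfType R d := (caratheodory_type (surf_outer R d)).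
Definition surf (R : realType) (d : nat)
    : {measure set (surfType R d) -> \bar R} :=
  surf_outer R d : set (surfType R d) -> \bar R.

Section geometry.
Context {R : realType} {d : nat}.

(* The vertices of a simplex are the rows of a matrix. *)
Definition face m (v : 'M[R]_(m, d)) (S : {set 'I_m}) : set 'rV[R]_d :=
  [set x | exists l : 'rV[R]_m,
    [/\ forall i, 0 <= l 0 i, forall i, i \notin S -> l 0 i = 0,
        \sum_i l 0 i = 1 & x = l *m v]].

Definition simplex m (v : 'M[R]_(m, d)) : set 'rV[R]_d := face v [set: 'I_m]%SET.

Definition affinely_independent m (v : 'M[R]_(m, d)) : bool :=
  row_free (row_mx v (const_mx 1 : 'cV[R]_m)).

Definition boundary (A : set 'rV[R]_d) : set 'rV[R]_d := closure A `\` A°.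

(* bounded polygonal ([d = 2]) or polyhedral ([d = 3]) domain: the boundary is
   a finite union of nondegenerate (d-1)-simplices *)
Definition polyhedral_domain (Omega : set 'rV[R]_d) : Prop :=
  [/\ open Omega, connected Omega, Omega !=set0, bounded_set Omega &
      exists F : seq 'M[R]_(d, d),
        all (@affinely_independent d) F /\
        boundary Omega = \bigcup_(v in [set` F]) simplex v].

(* conforming triangulation of the closure of [Omega]; the index set [S] may
   be empty, for disjoint elements *)
Definition triangulation (Omega : set 'rV[R]_d) (T : seq 'M[R]_(d.+1, d))
    : Prop :=
  [/\ all (@affinely_independent d.+1) T,
      closure Omega = \bigcup_(tau in [set` T]) simplex tau &
      forall tau tau', tau \in T -> tau' \in T ->
        exists S S' : {set 'I_d.+1},
          simplex tau `&` simplex tau' = face tau S /\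
          simplex tau `&` simplex tau' = face tau' S'].

End geometry.

Section L2.
Context {R : realType}.

Definition L2 disp (X : measurableType disp) (nu : {measure set X -> \bar R})
    (D : set X) (f : X -> R) : Prop :=
  measurable_fun D f /\ (\int[nu]_(x in D) (f x ^+ 2)%:E < +oo)%E.

Definition ip disp (X : measurableType disp) (nu : {measure set X -> \bar R})
    (D : set X) (f g : X -> R) : R :=
  \int[nu]_(x in D) (f x * g x).

(* for vector ([m = 1]) and tensor fields: the integrand is the Frobenius
   product *)
Definition ipM disp (X : measurableType disp) (nu : {measure set X -> \bar R})
    (D : set X) m n (F G : X -> 'M[R]_(m, n)) : R :=
  \int[nu]_(x in D) (\sum_i \sum_j F x i j * G x i j).

End L2.

Section fe.
Context {R : realType} {d : nat}.
Local Notation pt := 'rV[R]_d.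
Local Notation mesh := (seq 'M[R]_(d.+1, d)).

(* [P_k] on [A]: restrictions of polynomials of total degree at most [k] *)
Definition is_poly_on (k : nat) (A : set pt) (f : pt -> R) : Prop :=
  exists q : mpoly.mpoly d R,
    (mpoly.msize q <= k.+1)%N /\
    forall x, A x -> f x = mpoly.meval (fun j => x 0 j) q.

(* Functions on the closure of [Omega] are represented by total functions
   whose values elsewhere are irrelevant. *)
Definition continuous_piecewise_poly (k : nat) (Omega : set pt) (T : mesh)
    (f : pt -> R) : Prop :=
  {within closure Omega, continuous f} /\
  forall tau, tau \in T -> is_poly_on k (simplex tau) f.

(* The weak derivative of a continuous piecewise polynomial function is its
   elementwise classical derivative; the value on the null set of element
   boundaries is immaterial and set to 0. *)
Definition pderiv (T : mesh) (j : 'I_d) (f : pt -> R) (x : pt) : R :=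
  if `[< exists2 tau, tau \in T & (simplex tau)° x >]
  then 'D_(delta_mx 0 j) f x else 0.

Definition grad (T : mesh) (f : pt -> R) (x : pt) : 'rV[R]_d :=
  \row_j pderiv T j f x.

(* (Grad u) i j = d u_i / d x_j *)
Definition Grad (T : mesh) (u : pt -> pt) (x : pt) : 'M[R]_d :=
  \matrix_(i, j) pderiv T j (fun y => u y 0 i) x.

Definition div (T : mesh) (u : pt -> pt) (x : pt) : R := \tr (Grad T u x).

Definition strain (T : mesh) (u : pt -> pt) (x : pt) : 'M[R]_d :=
  2^-1 *: (Grad T u x + (Grad T u x)^T).

Definition L2norm (Omega : set pt) (f : pt -> R) : R :=
  Num.sqrt (ip (leb R d) Omega f f).

Definition L2normM (Omega : set pt) m n (F : pt -> 'M[R]_(m, n)) : R :=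
  Num.sqrt (ipM (leb R d) Omega F F).

Definition H1norm (Omega : set pt) (T : mesh) (u : pt -> pt) : R :=
  Num.sqrt (ipM (leb R d) Omega u u
            + ipM (leb R d) Omega (Grad T u) (Grad T u)).

End fe.

Record biot (R : realType) (d : nat) := Biot {
  Omega : set 'rV[R]_d;
  Gamma_d : set 'rV[R]_d;
  Gamma_t : set 'rV[R]_d;
  Gamma_p : set 'rV[R]_d;
  Gamma_f : set 'rV[R]_d;
  mu : R;
  lambda : R;
  c0 : R;
  alpha : R;
  Kc : R;                              (* hydraulic conductivity K *)
  dt : R;
  f_body : 'rV[R]_d -> 'rV[R]_d;       (* f *)
  h_traction : 'rV[R]_d -> 'rV[R]_d;   (* h *)
  Q_s : 'rV[R]_d -> R;
  g_2 : 'rV[R]_d -> R }.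

Section biot.
Context {R : realType} {d : nat}.
Variable B : biot R d.
Local Notation pt := 'rV[R]_d.
Local Notation mesh := (seq 'M[R]_(d.+1, d)).

Record biot_setting : Prop := {
  Omega_polyhedral : polyhedral_domain (Omega B);
  Gamma_dt : boundary (Omega B) = Gamma_d B `|` Gamma_t B;
  Gamma_pf : boundary (Omega B) = Gamma_p B `|` Gamma_f B;
  measurable_Gamma_d : measurable (Gamma_d B : set (surfType R d));
  measurable_Gamma_t : measurable (Gamma_t B : set (surfType R d));
  measurable_Gamma_p : measurable (Gamma_p B : set (surfType R d));
  measurable_Gamma_f : measurable (Gamma_f B : set (surfType R d));
  Gamma_d_gt0 : (0 < surf R d (Gamma_d B))%E;
  Gamma_p_gt0 : (0 < surf R d (Gamma_p B))%E;
  mu_gt0 : 0 < mu B;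
  lambda_gt0 : 0 < lambda B;
  c0_ge0 : 0 <= c0 B;
  alpha_gt0 : 0 < alpha B;
  Kc_gt0 : 0 < Kc B;
  dt_gt0 : 0 < dt B;
  f_body_L2 : forall k, L2 (leb R d) (Omega B) (fun x => f_body B x 0 k);
  h_traction_L2 :
    forall k, L2 (surf R d) (Gamma_t B) (fun x => h_traction B x 0 k);
  Q_s_L2 : L2 (leb R d) (Omega B) (Q_s B);
  g_2_L2 : L2 (surf R d) (Gamma_f B) (g_2 B) }.

Definition Vh (T : mesh) (v : pt -> pt) : Prop :=
  (forall k, continuous_piecewise_poly 2 (Omega B) T (fun x => v x 0 k)) /\
  forall x, Gamma_d B x -> v x = 0.

Definition Wh (T : mesh) (phi : pt -> R) : Prop :=
  continuous_piecewise_poly 1 (Omega B) T phi.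

Definition Mh (T : mesh) (psi : pt -> R) : Prop :=
  continuous_piecewise_poly 1 (Omega B) T psi /\
  forall x, Gamma_p B x -> psi x = 0.

(* The supremum is over the [v] of nonzero norm. *)
Definition stokes_stable (T : mesh) (beta : R) : Prop :=
  forall q, Wh T q ->
    ((beta * L2norm (Omega B) q)%:E <=
     ereal_sup [set (ip (leb R d) (Omega B) (div T v) q
                     / H1norm (Omega B) T v)%R%:E |
                v in [set v | Vh T v /\ (H1norm (Omega B) T v != 0)%R]])%E.

Local Notation ipO := (ip (leb R d) (Omega B)).
Local Notation ipMO := (ipM (leb R d) (Omega B)).

Definition momentum_eq (T : mesh) (u : pt -> pt) (xi : pt -> R)
    (v : pt -> pt) : Prop :=
  2 * mu B * ipMO (strain T u) (strain T v) - ipO xi (div T v)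
  = ipMO (f_body B) v + ipM (surf R d) (Gamma_t B) (h_traction B) v.

(* The previous displacement does not enter the n-th step. *)
Definition coupled_step (T : mesh) (xi_prev p_prev : pt -> R)
    (u : pt -> pt) (xi p : pt -> R) : Prop :=
  [/\ Vh T u, Wh T xi, Mh T p &
   forall v phi psi, Vh T v -> Wh T phi -> Mh T psi ->
   [/\ momentum_eq T u xi v,
       ipO (div T u) phi + (lambda B)^-1 * ipO xi phi
         - alpha B / lambda B * ipO p phi = 0 &
       (c0 B + alpha B ^+ 2 / lambda B) * ipO p psi
         - alpha B / lambda B * ipO xi psi
         + Kc B * dt B * ipMO (grad T p) (grad T psi)
       = dt B * ipO (Q_s B) psi
         + dt B * ip (surf R d) (Gamma_f B) (g_2 B) psi
         + (c0 B + alpha B ^+ 2 / lambda B) * ipO p_prev psi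
         - alpha B / lambda B * ipO xi_prev psi]].

(* [xi_prev], [p_prev]: previous time level; [xi_old]: previous iterate *)
Definition decoupled_step1 (T : mesh) (xi_prev p_prev xi_old p : pt -> R)
    : Prop :=
  Mh T p /\
  forall psi, Mh T psi ->
    (c0 B + alpha B ^+ 2 / lambda B) * ipO p psi
      + Kc B * dt B * ipMO (grad T p) (grad T psi)
    = (c0 B + alpha B ^+ 2 / lambda B) * ipO p_prev psi
      + alpha B / lambda B * ipO (fun x => xi_old x - xi_prev x) psi
      + dt B * ipO (Q_s B) psi
      + dt B * ip (surf R d) (Gamma_f B) (g_2 B) psi.

Definition decoupled_step2 (T : mesh) (p : pt -> R) (u : pt -> pt)
    (xi : pt -> R) : Prop :=
  [/\ Vh T u, Wh T xi &
   forall v phi, Vh T v -> Wh T phi ->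
     momentum_eq T u xi v /\
     ipO (div T u) phi + (lambda B)^-1 * ipO xi phi
     = alpha B / lambda B * ipO p phi].

(* The initialization is an equality of functions on the closure of
   [Omega]. *)
Definition decoupled_iterates (T : mesh) (u_prev : pt -> pt)
    (xi_prev p_prev : pt -> R) (u : nat -> pt -> pt) (xi p : nat -> pt -> R)
    : Prop :=
  [/\ forall x, closure (Omega B) x ->
        [/\ u 0%N x = u_prev x, xi 0%N x = xi_prev x & p 0%N x = p_prev x],
      forall i, (1 <= i)%N ->
        decoupled_step1 T xi_prev p_prev (xi i.-1) (p i) &
      forall i, (1 <= i)%N -> decoupled_step2 T (p i) (u i) (xi i)].

End biot.

(* Main.v *)
(** The errors of one iteration satisfy the scheme with zero data.  Write
    P, X, E for the norms of e_p^i, e_xi^i, strain(e_u^i), and X' for the norm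
    of e_xi^(i-1).  Testing the pressure equation with e_p^i and using c_0 = 0
    gives alpha P <= X'.  Testing the Stokes equations with (e_u^i, e_xi^i)
    gives 2 mu E^2 + X^2 / lambda <= (alpha / lambda) P X, and the inf-sup
    condition applied to e_xi^i gives beta X <= 2 mu E.  Eliminating P and E,
    X <= theta X' with theta = (1/lambda) / (1/lambda + beta^2/(2 mu)) < 1.

    The integrals are additive because all integrands that remain in the error
    equations are bounded and measurable on Omega. *)

Require Import Defs.
From HB Require Import structures.
From mathcomp Require Import all_boot all_order all_algebra.
From mathcomp Require Import all_classical all_reals all_analysis.
From mathcomp Require Import measurable_realfun.
From mathcomp Require Import ring lra.
From mathcomp Require mpoly.
Import (canonicals, coercions) mpoly.

Set Implicit Arguments.
Unset Strict Implicit.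
Unset Printing Implicit Defensive.
Import Order.TTheory GRing.Theory Num.Theory.
Import numFieldNormedType.Exports.
Local Open Scope classical_set_scope.
Local Open Scope ring_scope.

(** * Borel sets of R^d are Lebesgue measurable *)

(** Intersecting a countable cover of [X] with [H] and with its complement covers the two parts of
    [X]. If the gauge is superadditive under this cut, the two new sums add up to at most the old
    one, and the infimum over covers gives the Carathéodory inequality. *)
Lemma cover_outer_caratheodory (R : realType) (T : pointedType)
    (mu : {outer_measure set T -> \bar R}) (zeta : set T -> \bar R) (H : set T) :
  (forall A, 0 <= zeta A)%E -> (forall X, mu X = cover_outer zeta X) ->
  (forall A, zeta (A `&` H) + zeta (A `&` ~` H) <= zeta A)%E ->
  mu.-caratheodory H.
Proof.
move=> zeta_ge0 muE split_zeta; apply: le_caratheodory_measurable => X.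
rewrite !muE; apply: le_ereal_inf_tmp => _ [A XA <-].
apply: (@le_trans _ _ (\sum_(k <oo) (zeta (A k `&` H) + zeta (A k `&` ~` H)))%E).
  rewrite nneseriesD//; apply: leeD; apply: ereal_inf_lbound.
  - exists (fun k => A k `&` H) => //= x [/XA[k _ Akx] Hx].
    by exists k.
  - exists (fun k => A k `&` ~` H) => //= x [/XA[k _ Akx] Hx].
    by exists k.
by apply: lee_nneseries => // k _ _; exact: adde_ge0.
Qed.

Section lebesgue_measurability.
Context {R : realType} {d : nat}.
Local Notation pt := 'rV[R]_d.

(* A hyperplane orthogonal to a coordinate axis cuts a box into two boxes whose
   volumes add up. *)
Lemma box_gauge_split (j : 'I_d) (c : R) (A : set pt) :
  (box_gauge (A `&` [set x | (c < x 0%R j)%R]) +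
   box_gauge (A `&` ~` [set x | (c < x 0%R j)%R]) <= box_gauge A)%E.
Proof.
apply: le_ereal_inf_tmp => v [[-> ->]|[a [b [ab Aab ->]]]].
  by rewrite !set0I !box_gauge0 adde0.
(* [c] clamped to the j-th edge of the box *)
set m := Num.max (a 0 j) (Num.min c (b 0 j)).
have am : a 0 j <= m by rewrite /m le_max lexx.
have mb : m <= b 0 j by rewrite /m ge_max ab ge_min lexx orbT.
(* [a'] is the lower corner of the part above the hyperplane and [b'] the upper corner of the part
   below. Since [m] is clamped, corners stay ordered even when the hyperplane misses the box. *)
pose a' : pt := \row_k (if k == j then m else a 0 k).
pose b' : pt := \row_k (if k == j then m else b 0 k).
have volE (u w : pt) :
    \prod_k (w 0 k - u 0 k) = (w 0 j - u 0 j) * \prod_(k | k != j) (w 0 k - u 0 k).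
  by rewrite (bigD1 j).
rewrite (_ : \prod_k _ = \prod_k (b 0 k - a' 0 k) + \prod_k (b' 0 k - a 0 k)).
  rewrite EFinD; apply: leeD; apply: ereal_inf_lbound; right.
  - exists a', b; split => //.
      by move=> k; rewrite mxE; case: eqP => // ->.
    move=> x [/Aab xab /= cx] k; rewrite mxE; case: eqP => [->|_]; last exact: xab.
    have /andP[axj ->] := xab j; rewrite andbT /m gt_max axj/=.
    by rewrite gt_min cx.
  - exists a, b'; split => //.
      by move=> k; rewrite mxE; case: eqP => // ->.
    move=> x [/Aab xab /= cx] k; rewrite mxE; case: eqP => [->|_]; last exact: xab.
    have /andP[-> xbj] := xab j; rewrite /= /m le_max le_min xbj andbT.
    by move/negP: cx; rewrite -leNgt => ->; rewrite orbT.
rewrite !volE !mxE eqxx.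
rewrite [X in _ * X + _](eq_bigr (fun k => b 0 k - a 0 k)); last first.
  by move=> k kj; rewrite mxE (negbTE kj).
rewrite [X in _ + _ * X](eq_bigr (fun k => b 0 k - a 0 k)); last first.
  by move=> k kj; rewrite mxE (negbTE kj).
by rewrite -mulrDl addrA subrK.
Qed.

Lemma measurable_halfspace (j : 'I_d) (c : R) :
  measurable ([set x | c < x 0 j] : set (lebType R d)).
Proof.
apply: (@cover_outer_caratheodory R _ (leb_outer R d) (@box_gauge R d)) => //.
- exact: box_gauge_ge0.
- exact: box_gauge_split.
Qed.

Lemma measurable_box (a b : pt) : measurable (box a b : set (lebType R d)).
Proof.
have -> : box a b =
    \bigcap_j ([set x | a 0 j < x 0 j] `&` ~` [set x | b 0 j < x 0 j]).
  apply/seteqP; split => x.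
    move=> xab j _ /=; have /andP[? ?] := xab j.
    by split=> //; apply/negP; rewrite -leNgt.
  by move=> xab j; have [/= -> /negP] := xab j I; rewrite -leNgt.
apply: (@fin_bigcap_measurable _ (lebType R d)) => [|j _].
  exact: finite_finset.
apply: measurableI; first exact: measurable_halfspace.
by apply: measurableC; exact: measurable_halfspace.
Qed.

(** An open set is the countable union of the boxes with rational corners that it contains: around
    each point, such corners can be chosen within the radius of a maximum-norm ball inside [U]. *)
Lemma open_lebesgue_measurable (U : set pt) :
  open U -> measurable (U : set (lebType R d)).
Proof.
move=> oU.
pose ratv (q : 'rV[rat]_d) : pt := map_mx ratr q.
pose F (q : 'rV[rat]_d * 'rV[rat]_d) : set (lebType R d) :=
  if `[< box (ratv q.1) (ratv q.2) `<=` U >] then box (ratv q.1) (ratv q.2) else set0.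
have -> : U = \bigcup_q F q.
  apply/seteqP; split => x; last first.
    by move=> [q _]; rewrite /F; case: asboolP => // boxU /boxU.
  move=> Ux; have /nbhs_ballP[e /= e0 xeU] : nbhs x U by exact: open_nbhs_nbhs.
  have /choice[q1 q1P] : forall j, exists q : rat, ratr q \in `]x 0 j - e, x 0 j[.
    by move=> j; apply: rat_in_itvoo; rewrite ltrBlDr ltrDl.
  have /choice[q2 q2P] : forall j, exists q : rat, ratr q \in `]x 0 j, x 0 j + e[.
    by move=> j; apply: rat_in_itvoo; rewrite ltrDl.
  exists (\row_j q1 j, \row_j q2 j) => //; rewrite /F; case: asboolP => /=.
    move=> _ j; rewrite !mxE.
    have := q1P j; have := q2P j; rewrite !in_itv/= => /andP[? ?] /andP[? ?].
    by apply/andP; split => //; exact: ltW.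
  move=> notU; exfalso; apply: notU => y xy.
  apply: xeU; split => // i j; rewrite (ord1 i).
  have := xy j; rewrite !mxE => /andP[].
  have := q1P j; have := q2P j; rewrite !in_itv/= => /andP[_ q2e] /andP[q1e _].
  move=> qy yq; rewrite /ball/= ltr_distlC (lt_trans q1e qy)/=.
  exact: le_lt_trans yq q2e.
apply: countable_bigcupT_measurable => [|q]; first exact: countableP.
rewrite /F; case: asboolP => _; [exact: measurable_box|exact: measurable0].
Qed.

Lemma lebesgue_bounded_lty (U : set pt) (M : R) :
  (forall x, U x -> forall j, `|x 0 j| < M) -> (leb R d U < +oo)%E.
Proof.
move=> UM.
have gfin : (box_gauge U < +oo)%E.
  (* [M] may be negative when [U] is empty; the maximum keeps the corners of the enclosing box
     ordered. *)
  pose N := Num.max M 0.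
  apply: (@le_lt_trans _ _ (\prod_(j < d) (N - (- N)))%:E); last exact: ltry.
  apply: ereal_inf_lbound; right; exists (const_mx (- N)), (const_mx N); split.
  - by move=> j; rewrite !mxE ge0_cp// le_max lexx orbT.
  - move=> x /UM xM j; rewrite !mxE.
    have : `|x 0 j| < N by rewrite lt_max xM.
    by rewrite ltr_norml => /andP[-> /ltW].
  - by under [in RHS]eq_bigr do rewrite !mxE.
apply: le_lt_trans gfin.
(* The cover consists of [U] itself followed by empty sets of gauge 0. *)
apply: ereal_inf_lbound; exists (fun k => if k == 0%N then U else set0).
  by move=> x Ux; exists 0%N.
rewrite nneseries_recl//; last by move=> k _; exact: box_gauge_ge0.
rewrite (@eseries0 _ _ 1%N) ?adde0// => -[|k]// _ _; exact: box_gauge0.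
Qed.

Lemma continuous_measurable_fun (U : set pt) (f : pt -> R) :
  open U -> {in U, continuous f} ->
  measurable_fun (U : set (lebType R d)) f.
Proof.
move=> oU cf; apply: (measurability _ (RGenOpens.measurableE R)).
move=> _ [_ [a [b ->] <-]].
apply: open_lebesgue_measurable; rewrite openE => x [Ux fx].
apply: filterI; first exact: open_nbhs_nbhs.
by apply: (cf x (mem_set Ux)); exact: open_nbhs_nbhs.
Qed.

End lebesgue_measurability.

(** * Inner products of bounded measurable fields *)

Section bounded_measurable.
Context {R : realType} {disp : measure_display} {X : measurableType disp}.
Implicit Types (D : set X) (f g : X -> R).

(** This class is closed under sums and products, and its members are integrable on measurable sets
    of finite measure, so integrals of products of finite element functions can be split freely. *)
Definition bounded_measurable D f : Prop :=
  measurable_fun D f /\ exists M, forall x, D x -> `|f x| <= M.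

Lemma bounded_measurable_cst D (c : R) : bounded_measurable D (fun=> c).
Proof. by split; [exact: measurable_cst|exists `|c|]. Qed.

Lemma bounded_measurableD D f g :
  bounded_measurable D f -> bounded_measurable D g ->
  bounded_measurable D (fun x => f x + g x).
Proof.
move=> [mf [M fM]] [mg [N gN]]; split; first exact: measurable_funD.
by exists (M + N) => x Dx; rewrite (le_trans (ler_normD _ _))// lerD ?fM ?gN.
Qed.

Lemma bounded_measurableM D f g :
  bounded_measurable D f -> bounded_measurable D g ->
  bounded_measurable D (fun x => f x * g x).
Proof.
move=> [mf [M fM]] [mg [N gN]]; split; first exact: measurable_funM.
by exists (M * N) => x Dx; rewrite normrM ler_pM ?fM ?gN.
Qed.

Lemma bounded_measurable_sum D (I : Type) (s : seq I) (h : I -> X -> R) :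
  (forall i, bounded_measurable D (h i)) ->
  bounded_measurable D (fun x => \sum_(i <- s) h i x).
Proof.
move=> bh; elim: s => [|i s IH].
  by under eq_fun do rewrite big_nil; exact: bounded_measurable_cst.
by under eq_fun do rewrite big_cons; exact: bounded_measurableD.
Qed.

Lemma eq_bounded_measurable D f g :
  (forall x, D x -> f x = g x) ->
  bounded_measurable D f -> bounded_measurable D g.
Proof.
move=> fg [mf [M fM]]; split; last by exists M => x Dx; rewrite -fg ?fM.
by apply: eq_measurable_fun mf => x; rewrite inE => /fg.
Qed.

End bounded_measurable.

Section inner_products.
Context {R : realType} {disp : measure_display} {X : measurableType disp}.
Variables (nu : {measure set X -> \bar R}) (D : set X).
Hypotheses (mD : measurable D) (nuD : (nu D < +oo)%E).
Implicit Types (f g h : X -> R).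

Definition bounded_measurable_mx m n (F : X -> 'M[R]_(m, n)) : Prop :=
  forall i j, bounded_measurable D (fun x => F x i j).

Lemma bounded_measurable_integrable f :
  bounded_measurable D f -> nu.-integrable D (EFin \o f).
Proof.
move=> [mf [M fM]]; apply: measurable_bounded_integrable => //.
by exists M; split; [exact: num_real|move=> N MN x /fM /le_trans; apply; exact: ltW].
Qed.

Section mx.
Context {m n : nat}.
Implicit Types F G H : X -> 'M[R]_(m, n).

Lemma bounded_measurable_frobenius F G :
  bounded_measurable_mx F -> bounded_measurable_mx G ->
  bounded_measurable D (fun x => \sum_i \sum_j F x i j * G x i j).
Proof.
move=> bF bG; apply: bounded_measurable_sum => i.
by apply: bounded_measurable_sum => j; exact: bounded_measurableM.
Qed.

Lemma eq_ipM F G F' G' : (forall x, D x -> F x = F' x) ->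
  (forall x, D x -> G x = G' x) -> ipM nu D F G = ipM nu D F' G'.
Proof.
by move=> FF' GG'; apply: eq_Rintegral => x; rewrite inE => Dx; rewrite FF'// GG'.
Qed.

Lemma ipMC F G : ipM nu D F G = ipM nu D G F.
Proof.
apply: eq_Rintegral => x _; apply: eq_bigr => i _; apply: eq_bigr => j _.
exact: mulrC.
Qed.

Lemma ipM_ge0 F : 0 <= ipM nu D F F.
Proof.
apply: Rintegral_ge0 => x _; apply: sumr_ge0 => i _; apply: sumr_ge0 => j _.
by rewrite -expr2 sqr_ge0.
Qed.

(** One form of linearity serves both uses below: differences, with [a = -1], and the quadratic
    polynomial in the Cauchy-Schwarz argument. *)
Lemma ipMPl (a : R) F G H :
  bounded_measurable_mx F -> bounded_measurable_mx G -> bounded_measurable_mx H ->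
  ipM nu D (fun x => a *: F x + G x) H = a * ipM nu D F H + ipM nu D G H.
Proof.
move=> bF bG bH; rewrite /ipM.
have iFH : nu.-integrable D (EFin \o (fun x => \sum_i \sum_j F x i j * H x i j)).
  exact/bounded_measurable_integrable/bounded_measurable_frobenius.
rewrite -RintegralZl// -RintegralD//; last 2 first.
- apply: bounded_measurable_integrable; apply: bounded_measurableM.
    exact: bounded_measurable_cst.
  exact: bounded_measurable_frobenius.
- exact/bounded_measurable_integrable/bounded_measurable_frobenius.
apply: eq_Rintegral => x _; rewrite mulr_sumr -big_split; apply: eq_bigr => i _.
rewrite mulr_sumr -big_split; apply: eq_bigr => j _ /=.
by rewrite !mxE mulrDl mulrA.
Qed.

Lemma bounded_measurable_mxP (a : R) F G :
  bounded_measurable_mx F -> bounded_measurable_mx G ->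
  bounded_measurable_mx (fun x => a *: F x + G x).
Proof.
move=> bF bG i j; under eq_fun do rewrite !mxE.
apply: bounded_measurableD => //; apply: bounded_measurableM => //.
exact: bounded_measurable_cst.
Qed.

Lemma ipMBl F G H :
  bounded_measurable_mx F -> bounded_measurable_mx G -> bounded_measurable_mx H ->
  ipM nu D (fun x => F x - G x) H = ipM nu D F H - ipM nu D G H.
Proof.
move=> bF bG bH; under eq_fun do rewrite addrC -scaleN1r.
by rewrite ipMPl// mulN1r addrC.
Qed.

(** The polynomial [t ^+ 2 * a + 2 * t * b + c], the squared norm of [t *: F + G], is nonnegative
    for all [t]; evaluating it at a suitable [t] gives [b ^+ 2 <= a * c]. *)
Lemma ipM_cauchy_schwarz F G :
  bounded_measurable_mx F -> bounded_measurable_mx G ->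
  ipM nu D F G <= Num.sqrt (ipM nu D F F) * Num.sqrt (ipM nu D G G).
Proof.
move=> bF bG.
have q_ge0 t : 0 <= t ^+ 2 * ipM nu D F F + 2 * t * ipM nu D F G + ipM nu D G G.
  have := ipM_ge0 (fun x => t *: F x + G x).
  rewrite ipMPl//; last exact: bounded_measurable_mxP.
  rewrite (ipMC F) (ipMC G) !ipMPl//; try exact: bounded_measurable_mxP.
  by rewrite (ipMC G F); congr (0 <= _); ring.
move: q_ge0 (ipM_ge0 F) (ipM_ge0 G).
move: (ipM _ _ F F) (ipM _ _ F G) (ipM _ _ G G) => a b c q_ge0 a_ge0 c_ge0.
rewrite -sqrtrM//; have [b_le0|b_gt0] := leP b 0.
  by rewrite (le_trans b_le0) ?sqrtr_ge0.
rewrite -(ger0_norm (ltW b_gt0)) -sqrtr_sqr ler_wsqrtr//.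
(* If [a = 0] the polynomial is affine with positive slope, and the chosen [t] gives it the value
   [-1], a contradiction. Otherwise [- b / a] is its minimizer. *)
have [a0|a_neq0] := eqVneq a 0.
  have := q_ge0 (- (c + 1) / (2 * b)).
  have -> : 2 * (- (c + 1) / (2 * b)) * b = - (c + 1) by field; exact: lt0r_neq0.
  by rewrite a0; lra.
have := q_ge0 (- b / a).
have -> : (- b / a) ^+ 2 * a + 2 * (- b / a) * b + c = (a * c - b ^+ 2) / a by field.
by rewrite pmulr_lge0 ?subr_ge0// invr_gt0 lt_neqAle eq_sym a_neq0.
Qed.

End mx.

(** Scalar functions are viewed as 1 by 1 matrix fields, so the scalar rules below are instances of
    the matrix ones. *)
Lemma ip_ipM f g :
  ip nu D f g = ipM nu D (fun x => const_mx (f x) : 'M[R]_(1, 1))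
                         (fun x => const_mx (g x)).
Proof. by apply: eq_Rintegral => x _; rewrite !big_ord1 !mxE. Qed.

Lemma bounded_measurable_const_mx f :
  bounded_measurable D f ->
  bounded_measurable_mx (fun x => const_mx (f x) : 'M[R]_(1, 1)).
Proof. by move=> bf i j; under eq_fun do rewrite mxE. Qed.

Lemma ipC f g : ip nu D f g = ip nu D g f.
Proof. by rewrite !ip_ipM ipMC. Qed.

Lemma ip_ge0 f : 0 <= ip nu D f f.
Proof. by rewrite ip_ipM ipM_ge0. Qed.

Lemma ipBl f g h :
  bounded_measurable D f -> bounded_measurable D g -> bounded_measurable D h ->
  ip nu D (fun x => f x - g x) h = ip nu D f h - ip nu D g h.
Proof.
move=> /bounded_measurable_const_mx bf /bounded_measurable_const_mx bg.
move=> /bounded_measurable_const_mx bh; rewrite !ip_ipM -ipMBl//.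
by apply: eq_ipM => // x _; apply/matrixP => i j; rewrite !mxE.
Qed.

Lemma ip_cauchy_schwarz f g :
  bounded_measurable D f -> bounded_measurable D g ->
  ip nu D f g <= Num.sqrt (ip nu D f f) * Num.sqrt (ip nu D g g).
Proof.
move=> /bounded_measurable_const_mx bf /bounded_measurable_const_mx bg.
by rewrite !ip_ipM; exact: ipM_cauchy_schwarz.
Qed.

End inner_products.

(** * Piecewise polynomial functions *)

(** Polynomials are generated by constants and variables under sum and product. This lets the
    analytic properties of polynomial functions be proved without handling monomials. *)
Lemma mpoly_ring_ind (R : nzRingType) (n : nat) (P : mpoly.mpoly n R -> Prop) :
  (forall c, P (mpoly.mpolyC n c)) ->
  (forall i, P (mpoly.mpolyX R (mpoly.mnm1 i))) ->
  (forall q r, P q -> P r -> P (q + r)) ->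
  (forall q r, P q -> P r -> P (q * r)) ->
  forall q, P q.
Proof.
move=> PC PX PD PM q; rewrite [q]mpoly.mpolyE.
apply: big_ind => [|q1 r1|m _]; [by rewrite -(mpoly.mpolyC0 n R)|exact: PD|].
rewrite -mpoly.mul_mpolyC; apply: (PM _ _ (PC _)); rewrite mpoly.mpolyXE_id.
have P1 : P 1 by exact: PC 1.
apply: big_ind => [//|q1 r1|i _]; first exact: PM.
by elim: (m i) => [|k IH]; rewrite ?expr0// exprS; exact: PM.
Qed.

Section polynomial_functions.
Context {R : realType} {d : nat}.
Local Notation pt := 'rV[R]_d.

Definition polyfun (q : mpoly.mpoly d R) (x : pt) : R :=
  mpoly.meval (fun j => x 0 j) q.

Lemma polyfunC c : polyfun (mpoly.mpolyC d c) = cst c.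
Proof. by apply/funext => x; rewrite /polyfun mpoly.mevalC. Qed.

Lemma polyfunX i : polyfun (mpoly.mpolyX R (mpoly.mnm1 i)) = (fun x => x 0 i).
Proof. by apply/funext => x; rewrite /polyfun mpoly.mevalXU. Qed.

Lemma polyfunD q r : polyfun (q + r) = polyfun q + polyfun r.
Proof. by apply/funext => x; rewrite /polyfun mpoly.mevalD. Qed.

Lemma polyfunM q r : polyfun (q * r) = polyfun q * polyfun r.
Proof. by apply/funext => x; rewrite /polyfun mpoly.mevalM. Qed.

Lemma polyfun_continuous q : continuous (polyfun q).
Proof.
elim/mpoly_ring_ind: q => [c|i|q r cq cr|q r cq cr].
- by rewrite polyfunC => x; exact: cst_continuous.
- by rewrite polyfunX; exact: coord_continuous.
- by rewrite polyfunD => x; apply: continuousD; [exact: cq|exact: cr].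
- by rewrite polyfunM => x; apply: continuousM; [exact: cq|exact: cr].
Qed.

Lemma polyfun_bounded q (U : set pt) (M : R) :
  (forall x, U x -> forall j, `|x 0 j| < M) ->
  exists N, forall x, U x -> `|polyfun q x| <= N.
Proof.
move=> UM; elim/mpoly_ring_ind: q => [c|i|q r [N qN] [K rK]|q r [N qN] [K rK]].
- by rewrite polyfunC; exists `|c|.
- by rewrite polyfunX; exists M => x /UM xM; exact: ltW.
- rewrite polyfunD; exists (N + K) => x Ux.
  by rewrite (le_trans (ler_normD _ _))// lerD ?qN ?rK.
- rewrite polyfunM; exists (N * K) => x Ux.
  by rewrite [in leLHS]/GRing.mul/= normrM ler_pM ?qN ?rK.
Qed.

(** A coordinate is an entry of the identity map, whose derivative along [v] is [v]. *)
Lemma is_derive_coord (x v : pt) i : is_derive x v (fun y : pt => y 0 i) (v 0 i).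
Proof.
have did : derivable (@id pt) x v by exact: derivable_id.
apply: DeriveDef; first by have /derivable_mxP := did; apply.
have := derive_mx did; rewrite derive_id => /matrixP/(_ 0 i).
by rewrite mxE => <-.
Qed.

(** The derivative is again polynomial by the sum and Leibniz rules. Its degree is not tracked: only
    boundedness and measurability are drawn from it. *)
Lemma polyfun_derive q (v : pt) :
  exists q', forall x, is_derive x v (polyfun q) (polyfun q' x).
Proof.
elim/mpoly_ring_ind: q => [c|i|q r [q' qE] [r' rE]|q r [q' qE] [r' rE]].
- exists (mpoly.mpolyC d 0) => x; rewrite !polyfunC; exact: is_derive_cst.
- exists (mpoly.mpolyC d (v 0 i)) => x; rewrite polyfunX polyfunC.
  exact: is_derive_coord.
- exists (q' + r') => x; rewrite !polyfunD; exact: is_deriveD.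
- exists (q * r' + r * q') => x; rewrite polyfunD !polyfunM.
  exact: is_deriveM.
Qed.

Lemma is_poly_onB k (A : set pt) f g : is_poly_on k A f -> is_poly_on k A g ->
  is_poly_on k A (fun x => f x - g x).
Proof.
move=> [q [sq fq]] [r [sr gr]]; exists (q - r); split; last first.
  by move=> x Ax; rewrite fq// gr// mpoly.mevalB.
by rewrite (leq_trans (mpoly.msizeD_le _ _))// mpoly.msizeN geq_max sq.
Qed.

End polynomial_functions.

(** * Boundedness and measurability of piecewise polynomials *)

Section bounded_measurable_piecewise.
Context {R : realType} {d : nat}.
Local Notation pt := 'rV[R]_d.
Local Notation mesh := (seq 'M[R]_(d.+1, d)).

Lemma bounded_set_coord (U : set pt) : bounded_set U ->
  exists M : R, forall x, U x -> forall j, `|x 0 j| < M.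
Proof.
move=> [M [_ /(_ (M + 1))]]; rewrite ltrDl ltr01 => /(_ isT) UM.
(* The norm bound is available only for constants above [M], hence [M + 1]; the further unit makes
   the inequality strict. *)
exists (M + 2) => x /UM xM j; apply: (@le_lt_trans _ _ (M + 1)); last by lra.
apply: le_trans xM; rewrite /Num.norm/= mx_normrE.
exact: (le_bigmax _ (fun ij => `|x ij.1 ij.2|) (0, j)).
Qed.

Lemma bounded_measurable_setU (D E : set (lebType R d)) (f : pt -> R) :
  measurable D -> measurable E ->
  bounded_measurable D f -> bounded_measurable E f ->
  bounded_measurable (D `|` E) f.
Proof.
move=> mD mE [mfD [M fM]] [mfE [N fN]]; split; first exact/measurable_funU.
by exists (Num.max M N) => x [/fM|/fN] xM; rewrite le_max xM ?orbT.
Qed.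

Lemma polyfun_bounded_measurable q (D : set (lebType R d)) (M : R) :
  measurable D -> (forall x : pt, D x -> forall j, `|x 0 j| < M) ->
  bounded_measurable D (polyfun q).
Proof.
move=> mD DM; split; last exact: polyfun_bounded DM.
apply: (@measurable_funS _ _ _ _ setT) => //.
by apply: continuous_measurable_fun => [|x _]; [exact: openT|exact: polyfun_continuous].
Qed.

(** Induction on the mesh with [D] generalized: [D] is cut along the open interior of the first
    element. There [g] is a polynomial, and the rest of [D] is handled by the remaining elements. *)
Lemma piecewise_polyfun_bounded_measurable (T : mesh) (g : pt -> R)
    (D : set (lebType R d)) (M : R) :
  measurable D -> (forall x : pt, D x -> forall j, `|x 0 j| < M) ->
  (forall tau, tau \in T ->
     exists q, forall x, (simplex tau)° x -> g x = polyfun q x) ->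
  (forall x, D x -> ~ (exists2 tau, tau \in T & (simplex tau)° x) -> g x = 0) ->
  bounded_measurable D g.
Proof.
elim: T D => [|tau T IH] D mD DM gq g0.
  apply: eq_bounded_measurable (bounded_measurable_cst D 0) => x Dx.
  by rewrite g0// => -[].
pose U : set (lebType R d) := (simplex tau)°.
have mU : measurable U by apply: open_lebesgue_measurable; exact: open_interior.
rewrite -(setUIDK D U); apply: bounded_measurable_setU.
- exact: measurableI.
- exact: measurableD.
- have [q gqE] := gq tau (mem_head _ _).
  apply: (@eq_bounded_measurable _ _ (lebType R d) _ (polyfun q)).
    by move=> x [_ /gqE].
  apply: (@polyfun_bounded_measurable q _ M) => [|x [Dx _]]; first exact: measurableI.
  exact: DM.
- apply: IH => [|x [Dx _]|tau' T'|x [Dx Ux] nT].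
  + exact: measurableD.
  + exact: DM.
  + by apply: gq; rewrite inE T' orbT.
  + apply: g0 => // -[tau']; rewrite inE => /orP[/eqP-> //|T' xT'].
    by apply: nT; exists tau'.
Qed.

End bounded_measurable_piecewise.

(** * Finite element functions and their elementwise derivatives *)

Section finite_element_functions.
Context {R : realType} {d : nat}.
Local Notation pt := 'rV[R]_d.
Variables (Omega : set pt) (T : seq 'M[R]_(d.+1, d)) (k : nat).

Lemma continuous_piecewise_polyB (f g : pt -> R) :
  continuous_piecewise_poly k Omega T f -> continuous_piecewise_poly k Omega T g ->
  continuous_piecewise_poly k Omega T (fun x => f x - g x).
Proof.
move=> [cf pf] [cg pg]; split; first by move=> x; apply: cvgB; [exact: cf|exact: cg].
by move=> tau tauT; apply: is_poly_onB; [exact: pf|exact: pg].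
Qed.

(** Differentiation is local, and near an interior point of [A] the function coincides with its
    polynomial. *)
Lemma is_poly_on_derive (A : set pt) (f : pt -> R) (v : pt) : is_poly_on k A f ->
  exists q, forall x, A° x -> is_derive x v f (polyfun q x).
Proof.
move=> [q [_ fq]]; have [q' qE] := polyfun_derive q v; exists q' => x Ax.
apply: (near_eq_is_derive _ (qE x)).
by apply: filterS Ax => y /fq.
Qed.

Lemma pderiv_interior (f : pt -> R) j tau x : tau \in T -> (simplex tau)° x ->
  pderiv T j f x = 'D_(delta_mx 0 j) f x.
Proof. by move=> tauT taux; rewrite /pderiv asboolT//; exists tau. Qed.

(** Inside an element both functions are differentiable, being polynomial there; at all other points
    the three values are 0 by convention. *)
Lemma pderivB (f g : pt -> R) j x :
  continuous_piecewise_poly k Omega T f -> continuous_piecewise_poly k Omega T g ->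
  pderiv T j (fun y => f y - g y) x = pderiv T j f x - pderiv T j g x.
Proof.
move=> [_ pf] [_ pg]; rewrite /pderiv; case: asboolP => [[tau tauT taux]|_]; last first.
  by rewrite subr0.
have [q /(_ x taux) [df _]] := is_poly_on_derive (delta_mx 0 j) (pf tau tauT).
have [r /(_ x taux) [dg _]] := is_poly_on_derive (delta_mx 0 j) (pg tau tauT).
exact: deriveB.
Qed.

Hypotheses (oOmega : open Omega) (bOmega : bounded_set Omega).

Lemma pderiv_bounded_measurable (f : pt -> R) j :
  continuous_piecewise_poly k Omega T f ->
  bounded_measurable (Omega : set (lebType R d)) (pderiv T j f).
Proof.
move=> [_ pf]; have [M OM] := bounded_set_coord bOmega.
apply: (@piecewise_polyfun_bounded_measurable _ _ T _ _ M) => //.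
- exact: open_lebesgue_measurable.
- move=> tau tauT; have [q qE] := is_poly_on_derive (delta_mx 0 j) (pf tau tauT).
  exists q => x taux; rewrite (pderiv_interior _ _ tauT taux).
  by have [] := qE x taux.
- by move=> x _ notT; rewrite /pderiv asboolF.
Qed.

(** Measurability comes from continuity on the open set [Omega]; the bound comes from finitely many
    polynomials on elements that together cover [Omega]. *)
Lemma continuous_piecewise_poly_bounded_measurable (f : pt -> R) :
  closure Omega = \bigcup_(tau in [set` T]) simplex tau ->
  continuous_piecewise_poly k Omega T f ->
  bounded_measurable (Omega : set (lebType R d)) f.
Proof.
move=> cover [cf pf]; split.
  apply: continuous_measurable_fun => //; rewrite -continuous_open_subspace//.
  exact: continuous_subspaceW (@subset_closure _ Omega) cf.
have [M OM] := bounded_set_coord bOmega.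
have [N fN] : exists N, forall tau, tau \in T -> forall x, Omega x -> simplex tau x ->
    `|f x| <= N.
  (* The covering hypothesis stays outside the induction, as it fails for a sublist of the mesh. *)
  elim: (T) pf => [|tau S IH] pf; first by exists 0.
  have [|N fN] := IH; first by move=> tau' S'; apply: pf; rewrite inE S' orbT.
  have [q [_ fq]] := pf tau (mem_head _ _); have [K qK] := polyfun_bounded q OM.
  exists (Num.max K N) => tau'; rewrite inE => /orP[/eqP->|S'] x Ox taux.
    by rewrite le_max fq// qK.
  by rewrite le_max (fN tau')// orbT.
exists N => x Ox; have : closure Omega x by exact: subset_closure.
by rewrite cover => -[tau /= tauT taux]; exact: (fN tau).
Qed.

End finite_element_functions.

(** By induction [X] lies below the geometric sequence with first term [X 0] and ratio [theta]. *)
Lemma contraction_cvg0 (R : realType) (X : nat -> R) (theta : R) :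
  0 <= theta < 1 -> (forall i, 0 <= X i) ->
  (forall i, X i.+1 <= theta * X i) -> X @ \oo --> (0 : R).
Proof.
move=> /andP[theta_ge0 theta_lt1] X_ge0 Xtheta.
have XE i : X i <= geometric (X 0%N) theta i.
  elim: i => [|i IH]; first by rewrite /geometric/= expr0 mulr1.
  by rewrite (le_trans (Xtheta i))// /geometric/= exprS mulrCA ler_wpM2l.
apply: (@squeeze_cvgr _ _ _ _ (cst 0) (geometric (X 0%N) theta)).
- by apply: nearW => i; rewrite X_ge0 XE.
- exact: cvg_cst.
- by apply: cvg_geometric; rewrite ger0_norm.
Qed.

(** * Gradient, divergence and strain of finite element fields *)

Section vector_fields.
Context {R : realType} {d : nat}.
Local Notation pt := 'rV[R]_d.
Variables (Omega : set pt) (T : seq 'M[R]_(d.+1, d)) (k : nat).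
Implicit Types u v : pt -> pt.

Definition piecewise_poly_field u : Prop :=
  forall i, continuous_piecewise_poly k Omega T (fun x => u x 0 i).

Lemma piecewise_poly_fieldB u v :
  piecewise_poly_field u -> piecewise_poly_field v ->
  piecewise_poly_field (fun x => u x - v x).
Proof.
move=> pu pv i; under eq_fun do rewrite !mxE.
exact: continuous_piecewise_polyB.
Qed.

Lemma gradB (p q : pt -> R) x :
  continuous_piecewise_poly k Omega T p -> continuous_piecewise_poly k Omega T q ->
  grad T (fun y => p y - q y) x = grad T p x - grad T q x.
Proof.
move=> pp pq; apply/rowP => j; rewrite !mxE.
exact: (pderivB (k := k) (Omega := Omega)).
Qed.

Lemma GradB u v x : piecewise_poly_field u -> piecewise_poly_field v ->
  Grad T (fun y => u y - v y) x = Grad T u x - Grad T v x.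
Proof.
move=> pu pv; apply/matrixP => i j; rewrite !mxE.
under [X in pderiv _ _ X]eq_fun do rewrite !mxE.
exact: pderivB (pu i) (pv i).
Qed.

Lemma divB u v x : piecewise_poly_field u -> piecewise_poly_field v ->
  div T (fun y => u y - v y) x = div T u x - div T v x.
Proof. by move=> pu pv; rewrite /div GradB// raddfB. Qed.

Lemma strainB u v x : piecewise_poly_field u -> piecewise_poly_field v ->
  strain T (fun y => u y - v y) x = strain T u x - strain T v x.
Proof.
by move=> pu pv; rewrite /strain GradB// raddfB/= addrACA -opprD scalerBr.
Qed.

Hypotheses (oOmega : open Omega) (bOmega : bounded_set Omega).
Let D : set (lebType R d) := Omega.

Lemma grad_bounded_measurable (p : pt -> R) :
  continuous_piecewise_poly k Omega T p -> bounded_measurable_mx D (grad T p).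
Proof.
move=> pp i j; under eq_fun do rewrite mxE.
exact: pderiv_bounded_measurable pp.
Qed.

Lemma Grad_bounded_measurable u :
  piecewise_poly_field u -> bounded_measurable_mx D (Grad T u).
Proof.
move=> pu i j; under eq_fun do rewrite mxE.
exact: pderiv_bounded_measurable (pu i).
Qed.

Lemma div_bounded_measurable u :
  piecewise_poly_field u -> bounded_measurable D (div T u).
Proof.
move=> pu; apply: bounded_measurable_sum => i.
exact: Grad_bounded_measurable.
Qed.

Lemma strain_bounded_measurable u :
  piecewise_poly_field u -> bounded_measurable_mx D (strain T u).
Proof.
move=> pu i j; under eq_fun do rewrite !mxE.
apply: bounded_measurableM; first exact: bounded_measurable_cst.
by apply: bounded_measurableD;
  [have := Grad_bounded_measurable pu i j|have := Grad_bounded_measurable pu j i];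
  under eq_fun do rewrite mxE.
Qed.

(** Taking the symmetric part of a matrix does not increase its Frobenius norm, and the gradient
    part of the H1 norm is bounded by the whole. *)
Lemma L2norm_strain_le u : piecewise_poly_field u ->
  L2normM Omega (strain T u) <= H1norm Omega T u.
Proof.
move=> pu; rewrite ler_wsqrtr//.
apply: (@le_trans _ _ (ipM (leb R d) Omega (Grad T u) (Grad T u))); last first.
  by rewrite lerDr; exact: ipM_ge0.
have [M OM] := bounded_set_coord bOmega.
have mD : measurable D by exact: open_lebesgue_measurable.
have Dfin : (leb R d D < +oo)%E by exact: lebesgue_bounded_lty OM.
apply: le_Rintegral => //.
- apply: bounded_measurable_integrable => //.
  by apply: bounded_measurable_frobenius; exact: strain_bounded_measurable.
- apply: bounded_measurable_integrable => //.
  by apply: bounded_measurable_frobenius; exact: Grad_bounded_measurable.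
move=> x _; rewrite /strain; move: (Grad T u x) => G.
apply: (@le_trans _ _ (\sum_i \sum_j 2^-1 * (G i j ^+ 2 + G j i ^+ 2))).
  apply: ler_sum => i _; apply: ler_sum => j _; rewrite !mxE.
  rewrite -subr_ge0 (_ : _ - _ = 4^-1 * (G i j - G j i) ^+ 2); last by field.
  by rewrite mulr_ge0 ?sqr_ge0.
(* What remains is an equality: exchanging the order of summation identifies the two halves of the
   sum. *)
rewrite le_eqVlt; apply/orP; left; apply/eqP.
under eq_bigr do rewrite -mulr_sumr big_split/=.
rewrite -mulr_sumr big_split/= [X in _ + X]exchange_big/= -mulr2n.
rewrite -[X in _ * X = _]mulr_natl mulKf ?pnatr_eq0//.
Qed.

End vector_fields.

(** * Error equations *)

(** Subtracts two equations: an error equation follows once its residual is, by [ring], the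
    difference of the residuals of the two schemes. *)
Lemma eq_of_subr (V : zmodType) (a b a' b' c e : V) :
  a = b -> a' = b' -> c - e = (a - b) - (a' - b') -> c = e.
Proof. by move=> -> ->; rewrite !subrr => /eqP; rewrite subr_eq0 => /eqP. Qed.

Section iteration_error.
Context {R : realType} {d : nat} (B : biot R d) (T : seq 'M[R]_(d.+1, d)).
Hypotheses (hB : biot_setting B) (hT : triangulation (Omega B) T).
Local Notation pt := 'rV[R]_d.
Local Notation O := (Omega B).
Local Notation ipO := (ip (leb R d) O).
Local Notation ipMO := (ipM (leb R d) O).
Implicit Types (u v : pt -> pt) (xi p phi psi : pt -> R).

Let oO : open O. Proof. by have [] := Omega_polyhedral hB. Qed.
Let bO : bounded_set O. Proof. by have [] := Omega_polyhedral hB. Qed.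
Let mO : measurable (O : set (lebType R d)).
Proof. exact: open_lebesgue_measurable. Qed.
Let finO : (leb R d O < +oo)%E.
Proof. by have [M OM] := bounded_set_coord bO; exact: lebesgue_bounded_lty OM. Qed.

Lemma Wh_bounded_measurable phi : Wh B T phi ->
  bounded_measurable (O : set (lebType R d)) phi.
Proof.
by case: hT => _ cover _; exact: continuous_piecewise_poly_bounded_measurable.
Qed.

Lemma Vh_strain_bounded_measurable v : Vh B T v ->
  bounded_measurable_mx (O : set (lebType R d)) (strain T v).
Proof. by case=> pv _; exact: strain_bounded_measurable pv. Qed.

Lemma WhB xi phi : Wh B T xi -> Wh B T phi -> Wh B T (fun x => xi x - phi x).
Proof. exact: continuous_piecewise_polyB. Qed.

Lemma MhB p psi : Mh B T p -> Mh B T psi -> Mh B T (fun x => p x - psi x).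
Proof.
move=> [Wp p0] [Wpsi psi0]; split; first exact: WhB.
by move=> x Gx; rewrite p0// psi0// subrr.
Qed.

Lemma VhB u v : Vh B T u -> Vh B T v -> Vh B T (fun x => u x - v x).
Proof.
move=> [pu u0] [pv v0]; split; first exact: piecewise_poly_fieldB.
by move=> x Gx; rewrite u0// v0// subrr.
Qed.

Variables (xi_prev p_prev xi_old xi p xi' p' : pt -> R) (u u' : pt -> pt).
Hypotheses (Wxi_prev : Wh B T xi_prev) (Wxi_old : Wh B T xi_old).
Hypothesis coupled : coupled_step B T xi_prev p_prev u xi p.
Hypothesis step1 : decoupled_step1 B T xi_prev p_prev xi_old p'.
Hypothesis step2 : decoupled_step2 B T p' u' xi'.

Let eu : pt -> pt := fun x => u' x - u x.
Let exi : pt -> R := fun x => xi' x - xi x.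
Let ep : pt -> R := fun x => p' x - p x.
Let exi_old : pt -> R := fun x => xi_old x - xi x.

Let Vu : Vh B T u. Proof. by case: coupled. Qed.
Let Wxi : Wh B T xi. Proof. by case: coupled. Qed.
Let Mp : Mh B T p. Proof. by case: coupled. Qed.
Let Vu' : Vh B T u'. Proof. by case: step2. Qed.
Let Wxi' : Wh B T xi'. Proof. by case: step2. Qed.
Let Mp' : Mh B T p'. Proof. by case: step1. Qed.
(** The coupled step quantifies jointly over three test functions; zero fills the pressure slot when
    only one of the other two equations is wanted. *)
Let Mh0 : Mh B T (fun=> 0).
Proof.
have -> : (fun=> 0) = (fun x => p x - p x) by apply/funext => x; rewrite subrr.
exact: MhB.
Qed.

(** Sources, boundary flux and previous-level terms agree in both schemes and cancel. The decoupled
    pressure equation uses the lagged [xi_old], so the error of the preceding iterate remains on the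
    right. *)
Lemma pressure_error_eq psi : Mh B T psi ->
  (c0 B + alpha B ^+ 2 / lambda B) * ipO ep psi
    + Kc B * dt B * ipMO (grad T ep) (grad T psi)
  = alpha B / lambda B * ipO exi_old psi.
Proof.
move=> Mpsi.
have bpsi := Wh_bounded_measurable (proj1 Mpsi).
have bxi := Wh_bounded_measurable Wxi.
have gradE : ipMO (grad T ep) (grad T psi) =
    ipMO (grad T p') (grad T psi) - ipMO (grad T p) (grad T psi).
  have bgrad q : Mh B T q -> bounded_measurable_mx (O : set (lebType R d)) (grad T q).
    by case=> Wq _; exact: grad_bounded_measurable Wq.
  apply: etrans (ipMBl mO finO (bgrad _ Mp') (bgrad _ Mp) (bgrad _ Mpsi)).
  by apply: eq_ipM => // x _; exact: gradB (proj1 Mp') (proj1 Mp).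
have epE : ipO ep psi = ipO p' psi - ipO p psi.
  apply: ipBl => //; first exact: Wh_bounded_measurable (proj1 Mp').
  exact: Wh_bounded_measurable (proj1 Mp).
have exiE : ipO exi_old psi = ipO xi_old psi - ipO xi psi.
  by apply: ipBl => //; exact: Wh_bounded_measurable.
have xi_incrE : ipO (fun x => xi_old x - xi_prev x) psi =
    ipO xi_old psi - ipO xi_prev psi.
  by apply: ipBl => //; exact: Wh_bounded_measurable.
have := proj2 step1 psi Mpsi.
have [_ _ _ /(_ u xi psi Vu Wxi Mpsi) [_ _]] := coupled.
rewrite gradE epE exiE xi_incrE.
(* With every integral generalized to a real number, the claim is a linear combination of the two
   equations. *)
move: (ipO p' psi) (ipO p psi) (ipO xi_old psi) (ipO xi psi) (ipO xi_prev psi).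
move: (ipO p_prev psi) (ipO (Q_s B) psi) (ip (surf R d) (Gamma_f B) (g_2 B) psi).
move: (ipMO (grad T p') (grad T psi)) (ipMO (grad T p) (grad T psi)).
move: (dt B) (c0 B + _) (alpha B / _) (Kc B) => t c a K.
by move=> m1 m2 a1 a2 a3 a4 a5 a6 a7 a8 E1 E2; apply: (eq_of_subr E2 E1); ring.
Qed.

Lemma momentum_error_eq v : Vh B T v ->
  2 * mu B * ipMO (strain T eu) (strain T v) = ipO exi (div T v).
Proof.
move=> Vv.
have strainE : ipMO (strain T eu) (strain T v) =
    ipMO (strain T u') (strain T v) - ipMO (strain T u) (strain T v).
  have bstrain := Vh_strain_bounded_measurable.
  apply: etrans (ipMBl mO finO (bstrain _ Vu') (bstrain _ Vu) (bstrain _ Vv)).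
  by apply: eq_ipM => // x _; exact: strainB (proj1 Vu') (proj1 Vu).
have exiE : ipO exi (div T v) = ipO xi' (div T v) - ipO xi (div T v).
  apply: ipBl => //; try exact: Wh_bounded_measurable.
  exact: div_bounded_measurable (proj1 Vv).
have combine (c m1 m2 a1 a2 b : R) :
    c * m1 - a1 = b -> c * m2 - a2 = b -> c * (m1 - m2) = a1 - a2.
  by move=> E1 E2; apply: (eq_of_subr E1 E2); ring.
have [_ _ /(_ v xi Vv Wxi) [E1 _]] := step2.
have [_ _ _ /(_ v xi _ Vv Wxi Mh0) [E2 _ _]] := coupled.
by rewrite strainE exiE; exact: combine E1 E2.
Qed.

Lemma mass_error_eq phi : Wh B T phi ->
  ipO (div T eu) phi + (lambda B)^-1 * ipO exi phi = alpha B / lambda B * ipO ep phi.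
Proof.
move=> Wphi; have bphi := Wh_bounded_measurable Wphi.
have divE : ipO (div T eu) phi = ipO (div T u') phi - ipO (div T u) phi.
  have bdiv w : Vh B T w -> bounded_measurable (O : set (lebType R d)) (div T w).
    by case=> pw _; exact: div_bounded_measurable pw.
  apply: etrans (ipBl mO finO (bdiv _ Vu') (bdiv _ Vu) bphi).
  by apply: eq_Rintegral => x _; rewrite (divB _ (proj1 Vu') (proj1 Vu)).
have epE : ipO ep phi = ipO p' phi - ipO p phi.
  apply: ipBl => //; first exact: Wh_bounded_measurable (proj1 Mp').
  exact: Wh_bounded_measurable (proj1 Mp).
have exiE : ipO exi phi = ipO xi' phi - ipO xi phi.
  by apply: ipBl => //; exact: Wh_bounded_measurable.
have combine (a l d1 d2 x1 x2 p1 p2 : R) :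
    d1 + l * x1 = a * p1 -> d2 + l * x2 - a * p2 = 0 ->
    d1 - d2 + l * (x1 - x2) = a * (p1 - p2).
  by move=> E1 E2; apply: (eq_of_subr E1 E2); ring.
have [_ _ /(_ u phi Vu Wphi) [_ E1]] := step2.
have [_ _ _ /(_ u phi _ Vu Wphi Mh0) [_ E2 _]] := coupled.
by rewrite divE epE exiE; exact: combine E1 E2.
Qed.

(** Test with [ep]: the gradient term is nonnegative and is dropped, and Cauchy-Schwarz bounds the
    right-hand side. With [c0 B = 0] the leading coefficient is [alpha B ^+ 2 / lambda B], so a
    factor [alpha B / lambda B] cancels. *)
Lemma pressure_error_le : c0 B = 0 ->
  alpha B * L2norm O ep <= L2norm O exi_old.
Proof.
move=> hc0; have Mep : Mh B T ep by exact: MhB.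
have := pressure_error_eq Mep; rewrite hc0 add0r.
have := ipM_ge0 (leb R d) O (grad T ep).
have := ip_cauchy_schwarz mO finO
  (Wh_bounded_measurable (WhB Wxi_old Wxi)) (Wh_bounded_measurable (proj1 Mep)).
rewrite -/(L2norm O exi_old) -/(L2norm O ep).
have := ip_ge0 (leb R d) O ep => /sqr_sqrtr; rewrite -/(L2norm O ep) => <-.
have : 0 <= L2norm O ep by exact: sqrtr_ge0.
have : 0 <= L2norm O exi_old by exact: sqrtr_ge0.
move: (L2norm O ep) (L2norm O exi_old) (ipM _ _ _ _) (ip _ _ _ _) => P X G b.
move=> X0 P0 bXP G0 E.
have KG : 0 <= Kc B * dt B * G.
  exact: mulr_ge0 (mulr_ge0 (ltW (Kc_gt0 hB)) (ltW (dt_gt0 hB))) G0.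
have [a0 l0] := (alpha_gt0 hB, lambda_gt0 hB).
have al0 : 0 < alpha B / lambda B by rewrite divr_gt0.
have : alpha B / lambda B * (alpha B * P ^+ 2) <= alpha B / lambda B * (X * P).
  apply: (@le_trans _ _ (alpha B / lambda B * b)); last by rewrite ler_wpM2l// ltW.
  rewrite -E (_ : _ * (_ * _) = alpha B ^+ 2 / lambda B * P ^+ 2); last by ring.
  by rewrite lerDl.
rewrite ler_pM2l// expr2 mulrA.
(* Cancelling a factor [P] requires [P != 0]; for [P = 0] the claim is [0 <= X]. *)
have [->|P_neq0] := eqVneq P 0; first by move=> _; rewrite mulr0.
by rewrite ler_pM2r// lt_neqAle eq_sym P_neq0.
Qed.

(** Testing with [eu] and [exi] makes the same term, the product of [exi] and [div T eu], appear in
    both equations; eliminating it leaves the two energies, and Cauchy-Schwarz bounds the pressure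
    term. *)
Lemma energy_error_le :
  2 * mu B * L2normM O (strain T eu) ^+ 2 + (lambda B)^-1 * L2norm O exi ^+ 2
  <= alpha B / lambda B * (L2norm O ep * L2norm O exi).
Proof.
have Veu : Vh B T eu by exact: VhB.
have Wexi : Wh B T exi by exact: WhB.
have Mep : Mh B T ep by exact: MhB.
rewrite !sqr_sqrtr ?ip_ge0 ?ipM_ge0//.
rewrite (momentum_error_eq Veu) ipC (mass_error_eq Wexi) ler_wpM2l//.
  exact: divr_ge0 (ltW (alpha_gt0 hB)) (ltW (lambda_gt0 hB)).
apply: ip_cauchy_schwarz => //; apply: Wh_bounded_measurable => //.
by case: Mep.
Qed.

(** The momentum error equation rewrites each numerator of the supremum as a strain product. By
    Cauchy-Schwarz and the bound of the strain by the H1 norm, every quotient is at most the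
    right-hand side. *)
Lemma inf_sup_error_le beta : stokes_stable B T beta ->
  beta * L2norm O exi <= 2 * mu B * L2normM O (strain T eu).
Proof.
have Veu : Vh B T eu by exact: VhB.
have Wexi : Wh B T exi by exact: WhB.
move=> /(_ _ Wexi) stable; rewrite -lee_fin; apply: (le_trans stable).
apply: ge_ereal_sup => _ [v [Vv v_neq0] <-]; rewrite lee_fin.
have v_gt0 : 0 < H1norm O T v by rewrite lt_neqAle eq_sym v_neq0 sqrtr_ge0.
rewrite ler_pdivrMr// ipC -(momentum_error_eq Vv) -[leRHS]mulrA.
rewrite ler_wpM2l ?mulr_ge0 ?(ltW (mu_gt0 hB))//.
apply: le_trans (_ : _ <= L2normM O (strain T eu) * L2normM O (strain T v)) _.
  exact: (ipM_cauchy_schwarz mO finO (Vh_strain_bounded_measurable Veu)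
    (Vh_strain_bounded_measurable Vv)).
by rewrite ler_wpM2l ?sqrtr_ge0//; exact: L2norm_strain_le (proj1 Vv).
Qed.

End iteration_error.

(** * Contraction of the iteration and passage to the limit *)

Theorem mainTheorem3 (R : realType) (d : nat) (hd : d = 2%N \/ d = 3%N)
  (B : biot R d) (hB : biot_setting B)
  (* the family of triangulations T_h, h in Hs, and the uniform inf-sup
     constant *)
  (Hs : set R) (T : R -> seq 'M[R]_(d.+1, d))
  (hT : forall h, Hs h -> triangulation (Omega B) (T h))
  (beta0 : R) (hbeta0 : 0 < beta0)
  (hstable : forall h, Hs h -> stokes_stable B (T h) beta0)
  (h : R) (hh : Hs h)
  (n : nat) (hn : (1 <= n)%N)
  (* discrete solution of the coupled algorithm, indexed by the time level *)
  (u : nat -> 'rV[R]_d -> 'rV[R]_d) (xi p : nat -> 'rV[R]_d -> R)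
  (hu_prev : Vh B (T h) (u n.-1))
  (hxi_prev : Wh B (T h) (xi n.-1))
  (hp_prev : Mh B (T h) (p n.-1))
  (hcoupled : coupled_step B (T h) (xi n.-1) (p n.-1) (u n) (xi n) (p n))
  (* iterates of the decoupled algorithm within the n-th time step *)
  (u_it : nat -> 'rV[R]_d -> 'rV[R]_d) (xi_it p_it : nat -> 'rV[R]_d -> R)
  (hdecoupled : decoupled_iterates B (T h) (u n.-1) (xi n.-1) (p n.-1)
                  u_it xi_it p_it)
  (hc0 : c0 B = 0) :
  [/\ (fun i => L2norm (Omega B) (fun x => xi_it i x - xi n x)) @ \oo
        --> (0 : R),
      (fun i => L2normM (Omega B)
                  (strain (T h) (fun x => u_it i x - u n x))) @ \oo
        --> (0 : R) &
      (fun i => L2norm (Omega B) (fun x => p_it i x - p n x)) @ \oo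
        --> (0 : R)].
Proof.
have [_ it1 it2] := hdecoupled.
have [_ Wxin Mpn _] := hcoupled.
have hTh := hT h hh.
(* [xi_it 0] agrees with [xi n.-1] only on the closure of [Omega]; starting
   the estimates at the second iterate avoids it. *)
have Wxi_it i : Wh B (T h) (xi_it i.+1) by case: (it2 i.+1 isT).
have [[a0 l0] m0] := (alpha_gt0 hB, lambda_gt0 hB, mu_gt0 hB).
pose X i := L2norm (Omega B) (fun x => xi_it i x - xi n x).
pose E i := L2normM (Omega B) (strain (T h) (fun x => u_it i x - u n x)).
pose P i := L2norm (Omega B) (fun x => p_it i x - p n x).
have X_ge0 i : 0 <= X i by exact: sqrtr_ge0.
have E_ge0 i : 0 <= E i by exact: sqrtr_ge0.
have P_ge0 i : 0 <= P i by exact: sqrtr_ge0.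
have PX i : alpha B * P i.+2 <= X i.+1.
  exact: (pressure_error_le hB hTh hxi_prev (Wxi_it i) hcoupled (it1 i.+2 isT) hc0).
have energy i : 2 * mu B * E i.+2 ^+ 2 + (lambda B)^-1 * X i.+2 ^+ 2
    <= (lambda B)^-1 * (X i.+1 * X i.+2).
  apply: le_trans (energy_error_le hB hTh hcoupled
    (it1 i.+2 isT) (it2 i.+2 isT)) _.
  rewrite -/(P i.+2) -/(X i.+2) mulrAC mulrC ler_wpM2l ?invr_ge0 ?(ltW l0)//.
  by rewrite mulrA ler_wpM2r.
have infsup i : beta0 * X i.+2 <= 2 * mu B * E i.+2.
  exact: (inf_sup_error_le hB hTh hcoupled (it2 i.+2 isT) (hstable h hh)).
set l := (lambda B)^-1 in energy.
have l_gt0 : 0 < l by rewrite invr_gt0.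
(* Squaring the inf-sup bound and dividing by [2 * mu B] bounds [kappa * X i.+2 ^+ 2] by the strain
   energy. *)
pose kappa := beta0 ^+ 2 / (2 * mu B).
have kappa_gt0 : 0 < kappa by rewrite divr_gt0 ?exprn_gt0 ?mulr_gt0.
(* The energy estimate then gives [(l + kappa) * X i.+2 ^+ 2 <= l * (X i.+1 * X i.+2)], and a factor
   [X i.+2] is cancelled when it is nonzero. *)
pose theta := l / (l + kappa).
have theta_ge0 : 0 <= theta by rewrite divr_ge0 ?addr_ge0// ltW.
have theta_lt1 : theta < 1 by rewrite ltr_pdivrMr ?addr_gt0// mul1r ltrDl.
have kappaX i : kappa * X i.+2 ^+ 2 <= 2 * mu B * E i.+2 ^+ 2.
  rewrite /kappa mulrAC ler_pdivrMr ?mulr_gt0// -exprMn.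
  rewrite [leRHS](_ : _ = (2 * mu B * E i.+2) ^+ 2); last by ring.
  by rewrite ler_pXn2r ?nnegrE ?mulr_ge0// ltW.
have Xtheta i : X i.+2 <= theta * X i.+1.
  have [->|X_neq0] := eqVneq (X i.+2) 0; first exact: mulr_ge0.
  have X_gt0 : 0 < X i.+2 by rewrite lt_neqAle eq_sym X_neq0 X_ge0.
  rewrite /theta mulrAC ler_pdivlMr ?addr_gt0// -(ler_pM2r X_gt0).
  have := lerD (kappaX i) (lexx (l * X i.+2 ^+ 2)) => /le_trans/(_ (energy i)).
  by congr (_ <= _); ring.
have X_cvg : (fun i => X i.+1) @ \oo --> (0 : R).
  by apply: contraction_cvg0 Xtheta; rewrite ?theta_ge0.
(* The constant comes from [2 * mu B * E i.+2 ^+ 2 <= l * (X i.+1 * X i.+2)] together with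
   [X i.+2 <= X i.+1]. *)
have E_le i : E i.+2 <= Num.sqrt (l / (2 * mu B)) * X i.+1.
  rewrite -[X i.+1]ger0_norm// -sqrtr_sqr -sqrtrM; last first.
    by rewrite divr_ge0 ?mulr_ge0// ltW.
  rewrite -[leLHS]ger0_norm// -sqrtr_sqr ler_wsqrtr// mulrAC ler_pdivlMr ?mulr_gt0//.
  rewrite mulrC; apply: le_trans (_ : _ <= l * (X i.+1 * X i.+2)) _.
    by apply: le_trans (energy i); rewrite lerDl mulr_ge0 ?sqr_ge0// ltW.
  rewrite ler_wpM2l ?(ltW l_gt0)// expr2 ler_wpM2l//.
  by rewrite (le_trans (Xtheta i))// ler_piMl// ltW.
have P_le i : P i.+2 <= (alpha B)^-1 * X i.+1.
  by rewrite mulrC ler_pdivlMr// mulrC.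
(* All three errors at index [i.+2] are bounded by a multiple of [X i.+1]; dropping the first two
   terms leaves the limit unchanged. *)
have squeeze (F : nat -> R) (c : R) : (forall i, 0 <= F i) ->
    (forall i, F i.+2 <= c * X i.+1) -> F @ \oo --> (0 : R).
  move=> F_ge0 F_le; rewrite -(cvg_shiftn 2); under eq_fun do rewrite addn2.
  apply: (@squeeze_cvgr _ _ _ _ (cst 0) (fun i => c * X i.+1)).
  - by apply: nearW => i; rewrite F_ge0 F_le.
  - exact: cvg_cst.
  - by rewrite -[X in _ --> X](mulr0 c); apply: cvgMr.
split.
- exact: squeeze X_ge0 Xtheta.
- exact: squeeze E_ge0 E_le.
- exact: squeeze P_ge0 P_le.
Qed.
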